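(* The univariate box spline $B(x|(1,\sqrt{5/2}))$ is $\sqrt{10}$-indecomposable; that is, it cannot be written as the convolution of two $\sqrt{10}$-refinable splines.
   Context: The Fourier transform is $\widehat f(w)=\int_{-\infty}^{\infty} f(x)e^{-2\pi i w x}\,dx$. The univariate box spline $B(x|(1,\sqrt{5/2}))$ is the compactly supported function whose Fourier transform is $$ \frac{1-e^{-2\pi i w}}{2\pi i w}\cdot\frac{1-e^{-2\pi i\sqrt{5/2}\,w}}{2\pi i\sqrt{5/2}\,w} $$ (it is the convolution of the normalized indicator functions of $[0,1)$ and $[0,\sqrt{5/2})$). It is a $\sqrt{10}$-refinable spline. A spline is a piecewise polynomial function: there are points $-\infty=x_0<x_1<\cdots<x_M<x_{M+1}=+\infty$ and polynomials $P_j$ such that $f(x)=P_j(x)$ for $x\in[x_{j-1},x_j)$, $j=1,\dots,M+1$. For $\lambda>1$, a function $f$ is $\lambda$-refinable if $\widehat f(0)=1$ and $f(x)=\sum_{j=0}^N c_jf(\lambda x-d_j)$ for some $N$, real numbers $c_j$ and real numbers $d_0<\cdots<d_N$. A $\lambda$-refinable spline is called $\lambda$-indecomposable if it cannot be written as the convolution of two $\lambda$-refinable splines. *)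

(* Defs.v *)
From HB Require Import structures.
From mathcomp Require Import all_boot all_order all_algebra.
From mathcomp Require Import all_classical all_reals all_analysis.
From mathcomp Require Import complex.
Set Implicit Arguments.
Unset Strict Implicit.
Unset Printing Implicit Defensive.
Import Order.TTheory GRing.Theory Num.Theory.
Import numFieldNormedType.Exports.
Local Open Scope classical_set_scope.
Local Open Scope ring_scope.
Local Open Scope complex_scope.

Section RefinableSplines.
Variable R : realType.
Implicit Types (f g h B : R -> R) (lambda w t : R).

Local Notation mu := (@lebesgue_measure R).

(* e ^ (i t) *)
Definition expi t : R[i] := cos t +i* sin t.

(* The Fourier transform of a real-valued f at w, the integral of
   f x * e ^ (- 2 pi i w x), by real and imaginary parts. *)
Definition fourier f w : R[i] :=
  (\int[mu]_x (f x * cos (- (2 * pi * w * x)))%R)%R +i*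
  (\int[mu]_x (f x * sin (- (2 * pi * w * x)))%R)%R.

Definition convolution f g : R -> R := fun x => (\int[mu]_y (f y * g (x - y))%R)%R.

(* The knots k 0 = -oo < k 1 < ... < k M < k M.+1 = +oo are extended reals;
   the piece P j lives on [k j, k j.+1). Values of k and P at larger indices
   are irrelevant. *)
Definition spline f :=
  exists (M : nat) (k : nat -> \bar R) (P : nat -> {poly R}),
    [/\ k 0%N = -oo%E, k M.+1 = +oo%E,
        (forall j, (j <= M)%N -> (k j < k j.+1)%E) &
        (forall j x, (j <= M)%N -> (k j <= x%:E)%E -> (x%:E < k j.+1)%E ->
           f x = (P j).[x])].

Definition refinable lambda f :=
  [/\ mu.-integrable setT (EFin \o f), fourier f 0 = 1 &
      exists (N : nat) (c d : 'I_N.+1 -> R),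
        {homo d : i j / (i < j)%N >-> i < j} /\
        forall x, f x = \sum_(j < N.+1) c j * f (lambda * x - d j)].

Definition refinable_spline lambda f := spline f /\ refinable lambda f.

Definition indecomposable lambda f :=
  refinable_spline lambda f /\
  ~ exists g h, [/\ refinable_spline lambda g, refinable_spline lambda h &
                    f =1 convolution g h].

Definition compactly_supported f := compact (closure [set x | f x != 0]).

(* B(x|(u_1, ..., u_n)). The Fourier transform determines B up to a null set
   only; the requirement [spline B] (pieces on half-open intervals) selects
   one representative. The formula has a removable singularity at w = 0, where
   the division of the library would give 0, hence the restriction w != 0. *)
Definition box_spline (us : seq R) B :=
  [/\ spline B, compactly_supported B &
      forall w, w != 0 ->
        fourier B w =
        \prod_(u <- us)
          ((1 - expi (- (2 * pi * u * w))) / (2 * pi%:C * 'i * u%:C * w%:C))].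

End RefinableSplines.

(* Main.v *)
(** Write [lam = sqrt 10] and [m = sqrt (5/2)], so [lam = 2 m] and [lam m = 5].
    A compactly supported spline is encoded by its jumps: the formal sum of the
    terms [c T^n z^y], one for each jump [c] of the derivative of order [n - 1]
    at the knot [y]. Formal sums form a domain (order the exponents [(n, y)]
    lexicographically), convolution is their product, and both the Fourier
    transform and the values of the spline determine them. The box spline is
    [T^2 (1 - z) (1 - z^m) / m].

    If it equals [G H], then comparing degrees in [T] shows that [G] and [H] have
    degree 1, hence [G = T * sum_y c_y z^y], of integral [- sum_y c_y y].
    Choose an additive [sigma] on the reals with [sigma 1 = 1] and
    [sigma (lam x) = - lam (sigma x)], and put [p = (id - sigma) / 2] and
    [q = (id + sigma) / 2]. Since [p 1 = 0], applying [p] to the exponents kills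
    [1 - z], so it kills a factor, say [G]. Since [p (lam x) = lam (q x)], the
    refinement equation shows that [q] kills [G] as well. As [y = p y + q y],
    the integral of the spline with jumps [G] is then 0 instead of 1. *)
Require Import Defs.
From mathcomp Require Import all_boot all_order all_algebra.
From mathcomp Require Import all_classical all_reals all_analysis.
From mathcomp Require Import complex.
From mathcomp Require Import ring lra zify.
From mathcomp Require polyrcf.
Set Implicit Arguments.
Unset Strict Implicit.
Unset Printing Implicit Defensive.
Import Order.TTheory GRing.Theory Num.Theory.
Import numFieldNormedType.Exports.
Local Open Scope ring_scope.

(** * Formal sums as elements of a monoid algebra *)

Section GroupRing.
Variables (F : idomainType) (V : nmodType).
Implicit Types (D : seq (F * V)) (Phi : V -> F) (v : V).

(** Lists are not normalized: exponents may recur and coefficients may cancel. Equality of formal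
    sums is therefore equality of [gcoef], and [gsum Phi] is the linear functional with value
    [Phi v] at the exponent [v]. *)
Definition gsum Phi D := \sum_(t <- D) t.1 * Phi t.2.
Definition gcoef D v := gsum (fun u => (u == v)%:R) D.
Definition gmul D D' : seq (F * V) :=
  [seq (t.1 * t'.1, t.2 + t'.2) | t <- D, t' <- D'].
Definition gopp D : seq (F * V) := [seq (- t.1, t.2) | t <- D].

Lemma gsum_cat Phi D D' : gsum Phi (D ++ D') = gsum Phi D + gsum Phi D'.
Proof. by rewrite /gsum big_cat. Qed.

Lemma gsum_opp Phi D : gsum Phi (gopp D) = - gsum Phi D.
Proof. by rewrite /gsum big_map -sumrN; apply: eq_bigr => t _; rewrite mulNr. Qed.

Lemma gsum_mul Phi D D' :
  gsum Phi (gmul D D') = gsum (fun u => gsum (fun v => Phi (u + v)) D') D.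
Proof.
rewrite /gsum big_allpairs_dep; apply: eq_bigr => t _; rewrite mulr_sumr.
by apply: eq_bigr => t' _; rewrite mulrA.
Qed.

(** Collecting equal exponents shows that a linear functional depends on the coefficients only, not
    on the list that represents them. *)
Lemma gsum_coef Phi D :
  gsum Phi D = \sum_(v <- undup (map snd D)) gcoef D v * Phi v.
Proof.
under [RHS]eq_bigr do rewrite /gcoef /gsum mulr_suml.
rewrite exchange_big; apply: eq_big_seq => t tD /=.
have tu : t.2 \in undup (map snd D) by rewrite mem_undup map_f.
rewrite (bigD1_seq t.2) ?undup_uniq //= eqxx mulr1 big1 ?addr0 // => v /negPf vt.
by rewrite eq_sym vt mulr0 mul0r.
Qed.

Lemma eq_gsum_support Phi Psi D :
  (forall v, gcoef D v != 0 -> Phi v = Psi v) -> gsum Phi D = gsum Psi D.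
Proof.
move=> PhiPsi; rewrite !gsum_coef; apply: eq_bigr => v _.
by case: (eqVneq (gcoef D v) 0) => [->|/PhiPsi ->//]; rewrite !mul0r.
Qed.

Lemma eq_gsum Phi Psi D : Phi =1 Psi -> gsum Phi D = gsum Psi D.
Proof. by move=> e; apply: eq_gsum_support => v _; exact: e. Qed.

Lemma eq_gcoef_gsum Phi D D' : gcoef D =1 gcoef D' -> gsum Phi D = gsum Phi D'.
Proof.
move=> DD'; apply/eqP; rewrite -subr_eq0 -gsum_opp -gsum_cat gsum_coef big1 //.
by move=> v _; rewrite /gcoef gsum_cat gsum_opp -!/(gcoef _ _) DD' subrr mul0r.
Qed.

Lemma gsum_eq0 Phi D : gcoef D =1 (fun=> 0) -> gsum Phi D = 0.
Proof. by move=> D0; rewrite gsum_coef big1 // => v _; rewrite D0 mul0r. Qed.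

Lemma gsumD Phi Psi D :
  gsum (fun v => Phi v + Psi v) D = gsum Phi D + gsum Psi D.
Proof. by rewrite /gsum -big_split; apply: eq_bigr => t _; rewrite mulrDr. Qed.

Lemma gsumMl a Phi D : gsum (fun v => a * Phi v) D = a * gsum Phi D.
Proof. by rewrite /gsum mulr_sumr; apply: eq_bigr => t _; rewrite mulrCA. Qed.

Lemma gsum_gsumC (Phi : V -> V -> F) D D' :
  gsum (fun u => gsum (Phi u) D') D = gsum (fun v => gsum (Phi^~ v) D) D'.
Proof.
rewrite /gsum; under eq_bigr do rewrite mulr_sumr.
rewrite exchange_big; apply: eq_bigr => t _; rewrite mulr_sumr.
by apply: eq_bigr => t' _; rewrite mulrCA.
Qed.

Lemma gmul_comm D D' : gcoef (gmul D D') =1 gcoef (gmul D' D).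
Proof.
move=> v; rewrite /gcoef !gsum_mul gsum_gsumC.
by apply: eq_gsum => u; apply: eq_gsum => w; rewrite addrC.
Qed.

Lemma seq_max (T : eqType) (le : rel T) (s : seq T) x :
  reflexive le -> total le -> transitive le -> x \in s ->
  exists2 y, y \in s & forall z, z \in s -> le z y.
Proof.
move=> le_refl le_total le_trans; elim: s x => // a [|b s] IHs x _.
  by exists a; rewrite ?inE // => z; rewrite inE => /eqP ->.
have [y ys ymax] := IHs b (mem_head _ _).
case/orP: (le_total a y) => ay.
  by exists y; [rewrite inE ys orbT | move=> z; rewrite inE => /predU1P[->|/ymax]].
exists a; first exact: mem_head.
by move=> z; rewrite inE => /predU1P[->|/ymax zy]; [exact: le_refl|exact: le_trans ay].
Qed.

Lemma gcoef_mem D v : gcoef D v != 0 -> v \in map snd D.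
Proof.
apply: contra_neqT => vD; rewrite /gcoef /gsum big_seq big1 // => t tD.
case: eqP => [tv|]; last by rewrite mulr0.
by rewrite -tv map_f in vD.
Qed.

Lemma gcoef_max (le : rel V) D v0 :
  reflexive le -> total le -> transitive le -> gcoef D v0 != 0 ->
  exists2 v, gcoef D v != 0 & forall w, gcoef D w != 0 -> le w v.
Proof.
move=> le_refl le_total le_trans Dv0.
have := @seq_max _ le [seq v <- map snd D | gcoef D v != 0] v0 le_refl le_total le_trans.
rewrite mem_filter Dv0 gcoef_mem // => /(_ isT) [v].
rewrite mem_filter => /andP[Dv _] vmax; exists v => // w Dw.
by apply: vmax; rewrite mem_filter Dw gcoef_mem.
Qed.

(** When [u + v] decomposes in only one way over the two supports, a single product of coefficients
    lands there and nothing can cancel it. *)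
Lemma gcoef_mul_top D D' u v :
  (forall x y, gcoef D x != 0 -> gcoef D' y != 0 -> x + y = u + v ->
     x = u /\ y = v) ->
  gcoef (gmul D D') (u + v) = gcoef D u * gcoef D' v.
Proof.
move=> uniq_uv.
have -> : gcoef D u * gcoef D' v =
    gsum (fun x => gsum (fun y => (x == u)%:R * (y == v)%:R) D') D.
  under [RHS]eq_gsum do rewrite gsumMl.
  by rewrite /gcoef /gsum mulr_suml; apply: eq_bigr => t _; rewrite mulrA.
rewrite /gcoef gsum_mul; apply: eq_gsum_support => x Dx.
apply: eq_gsum_support => y Dy; case: eqP => [xy|nxy].
  by have [-> ->] := uniq_uv _ _ Dx Dy xy; rewrite !eqxx mulr1.
by case: (eqVneq x u) => [xu|]; case: (eqVneq y v) => [yv|];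
  rewrite ?mul0r ?mulr0 //; case: nxy; rewrite xu yv.
Qed.

End GroupRing.

(** * Change of exponents along a map *)

Section Push.
Variables (F : idomainType) (V W : nmodType).

(** For additive [theta] this is the induced homomorphism of monoid algebras; distinct exponents may
    be merged. *)
Definition gpush (theta : V -> W) (D : seq (F * V)) : seq (F * W) :=
  [seq (t.1, theta t.2) | t <- D].

Lemma gsum_push theta Phi D :
  gsum Phi (gpush theta D) = gsum (fun v => Phi (theta v)) D.
Proof. by rewrite /gsum big_map. Qed.

Lemma gpush_mul theta D D' : {morph theta : u v / u + v} ->
  gcoef (gpush theta (gmul D D')) =1 gcoef (gmul (gpush theta D) (gpush theta D')).
Proof.
move=> thetaD w; rewrite /gcoef gsum_push !gsum_mul gsum_push.
by apply: eq_gsum => u; rewrite gsum_push; apply: eq_gsum => v; rewrite thetaD.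
Qed.

Lemma eq_gcoef_push theta D D' :
  gcoef D =1 gcoef D' -> gcoef (gpush theta D) =1 gcoef (gpush theta D').
Proof. by move=> DD' w; rewrite /gcoef !gsum_push (eq_gcoef_gsum _ DD'). Qed.

End Push.

(** * Lexicographic leading terms and absence of zero divisors *)

Section Lexicographic.
Variables (F : idomainType) (R : realFieldType).
Implicit Types D : seq (F * (nat * R)).

Definition lexle (u v : nat * R) :=
  (u.1 < v.1)%N || (u.1 == v.1) && (u.2 <= v.2).

Lemma lexle_refl : reflexive lexle.
Proof. by move=> u; rewrite /lexle eqxx lexx orbT. Qed.

Lemma lexle_total : total lexle.
Proof.
move=> u v; rewrite /lexle; case: (ltngtP u.1 v.1) => //= _.
by rewrite le_total.
Qed.

Lemma lexle_trans : transitive lexle.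
Proof.
move=> v u w /orP[uv|/andP[/eqP uv uv2]] /orP[vw|/andP[/eqP vw vw2]];
  apply/orP; rewrite -?vw ?uv ?vw; auto.
- by left; apply: ltn_trans vw.
- by right; rewrite eqxx (le_trans uv2).
Qed.

Lemma lexle_add u v x y : lexle x u -> lexle y v -> x + y = u + v ->
  x = u /\ y = v.
Proof.
case: u v x y => [m a] [n b] [i c] [j d]; rewrite /lexle /= => xu yv e.
have e1 : (i + j = m + n)%N := congr1 fst e.
have e2 : c + d = a + b := congr1 snd e.
have [ei ej] : i = m /\ j = n.
  have xu1 : (i <= m)%N by case/orP: xu => [/ltnW|/andP[/eqP -> _]].
  have yv1 : (j <= n)%N by case/orP: yv => [/ltnW|/andP[/eqP -> _]].
  by lia.
move: xu yv; rewrite ei ej !ltnn !eqxx /= => ca db.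
by split; rewrite ?ei ?ej; congr (_, _); lra.
Qed.

(** The witnesses are the leading exponents of the two factors, whose product cannot cancel. Their
    comparison with [u0] and [v0] is kept for the degree count in [factor_degree]. *)
Lemma gcoef_mul_lex D D' u0 v0 : gcoef D u0 != 0 -> gcoef D' v0 != 0 ->
  exists u v, [/\ lexle u0 u, lexle v0 v & gcoef (gmul D D') (u + v) != 0].
Proof.
move=> Du0 Dv0.
have [u Du umax] := gcoef_max lexle_refl lexle_total lexle_trans Du0.
have [v Dv vmax] := gcoef_max lexle_refl lexle_total lexle_trans Dv0.
exists u, v; split; [exact: umax|exact: vmax|].
rewrite gcoef_mul_top ?mulf_neq0 // => x y /umax xu /vmax yv.
exact: lexle_add.
Qed.

Lemma gmul_eq0 D D' : gcoef (gmul D D') =1 (fun=> 0) ->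
  gcoef D =1 (fun=> 0) \/ gcoef D' =1 (fun=> 0).
Proof.
move=> DD'; have [D0|/existsNP[u /eqP Du]] := pselect (forall u, gcoef D u = 0).
  by left.
have [D0|/existsNP[v /eqP Dv]] := pselect (forall v, gcoef D' v = 0); first by right.
by have [x [y [_ _]]] := gcoef_mul_lex Du Dv; rewrite DD' eqxx.
Qed.

End Lexicographic.

(** * Linear independence of truncated powers *)

Section TruncatedPowers.
Variable R : realFieldType.
Implicit Types (D : seq (R * (nat * R))) (x y : R) (v : nat * R).

(** The points [a + (b - a) / (k + 2)] are distinct roots inside the interval, and [size p] of them
    exceed the degree. *)
Lemma poly_eq0_itv (p : {poly R}) a b : a < b ->
  (forall x, a <= x < b -> p.[x] = 0) -> p = 0.
Proof.
move=> ab p0; pose f k : R := a + (b - a) / k.+2%:R.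
apply: (@roots_geq_poly_eq0 _ p [seq f k | k <- iota 0 (size p)]).
- apply/allP => _ /mapP[k _ ->]; apply/rootP; apply: p0.
  have k0 : 0 < k.+2%:R :> R by rewrite ltr0n.
  have k1 : 1 < k.+2%:R :> R by rewrite ltr1n.
  have k2 : k.+2%:R^-1 < 1 :> R by rewrite invf_lt1.
  have k3 : 0 < k.+2%:R^-1 :> R by rewrite invr_gt0.
  by rewrite /f lerDl -ltrBrDl gtr_pMr ?subr_gt0 // k2 mulr_ge0 ?subr_ge0 // ltW.
- rewrite map_inj_uniq ?iota_uniq // => i j /addrI /mulfI.
  move/(_ _); rewrite subr_eq0 gt_eqF // => /(_ isT) /invr_inj /eqP.
  by rewrite eqr_nat => /eqP[].
- by rewrite size_map size_iota.
Qed.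

Lemma right_gap y (s : seq R) :
  exists2 e, y < e & forall z, z \in s -> y < z -> e <= z.
Proof.
elim: s => [|a s [e ye es]]; first by exists (y + 1); rewrite // ltrDl.
case: (ltP y a) => ya.
  exists (Num.min e a) => [|z]; first by rewrite lt_min ye.
  rewrite inE ge_min => /predU1P[->|zs yz]; first by rewrite lexx orbT.
  by rewrite es.
exists e => // z; rewrite inE => /predU1P[->|]; last exact: es.
by rewrite ltNge ya.
Qed.

(* The exponent [n] is shifted: [trunc x (n, y)] is the [n]-fold iterated
   integral, for [n >= 1], of the unit mass at [y]. *)
Definition trunc x v : R :=
  if v.2 <= x then (x - v.2) ^+ v.1.-1 / (v.1.-1)`!%:R else 0.

(** Between the leftmost knot [y] of the support and the next one, only the terms at [y] are active.
    They form a polynomial in [x - y] that vanishes on an interval, and its coefficients are those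
    of [D] up to factorials. Positive degrees make [n |-> n.-1] injective. *)
Lemma trunc_indep D : (forall t, t \in D -> (0 < t.2.1)%N) ->
  (forall x, gsum (trunc x) D = 0) -> gcoef D =1 (fun=> 0).
Proof.
move=> D_gt0 D0 v0; apply/eqP; apply: contrapT => /negP Dv0.
have [[n y] Dv vmin] := @gcoef_max _ _ (fun u v => v.2 <= u.2) D v0
  (fun=> lexx _) (fun u v => le_total _ _) (fun u v w h1 h2 => le_trans h2 h1) Dv0.
have [e ye es] := right_gap y [seq t.2.2 | t <- D].
pose q : {poly R} :=
  \sum_(t <- D | t.2.2 == y) (t.1 / (t.2.1.-1)`!%:R) *: 'X^(t.2.1.-1).
have q0 : q = 0.
  apply: (@poly_eq0_itv _ 0 (e - y)); rewrite ?subr_gt0 // => x /andP[x0 xe].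
  rewrite -[RHS](D0 (x + y)) (@eq_gsum_support _ _ _
    (fun w => if w.2 == y then x ^+ w.1.-1 / (w.1.-1)`!%:R else 0)).
    rewrite horner_sum /gsum big_mkcond; apply: eq_bigr => t _.
    by case: eqP => _; rewrite ?mulr0 // hornerZ hornerXn; ring.
  move=> w Dw; rewrite /trunc; case: eqVneq => [->|wy].
    by rewrite lerDr x0 addrK.
  rewrite ifF //; apply/negbTE; rewrite -ltNge (@lt_le_trans _ _ e) -?ltrBrDr //.
  apply: es; last by rewrite lt_neqAle eq_sym wy vmin.
  by have /mapP[t tD ->] := gcoef_mem Dw; rewrite (map_f (fun t => t.2.2)).
have n_gt0 : (0 < n)%N by have /mapP[t /D_gt0 + e'] := gcoef_mem Dv; rewrite -e'.
move: Dv; rewrite (_ : gcoef D (n, y) = q`_n.-1 * (n.-1)`!%:R).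
  by rewrite q0 coef0 mul0r eqxx.
rewrite /gcoef /gsum coef_sum mulr_suml [RHS]big_mkcond.
apply: eq_big_seq => t /D_gt0 t_gt0; rewrite -pair_eqE /= coefZ coefXn.
rewrite -(eqn_add2r 1) !addn1 !prednK // [n == _]eq_sym andbC.
case: (t.2.2 == y); rewrite ?mulr0 //=; case: eqP => [->|]; rewrite ?mulr0 ?mul0r //.
by rewrite !mulr1 divfK // pnatr_eq0 -lt0n fact_gt0.
Qed.

End TruncatedPowers.

(** * Linear independence of characters with polynomial coefficients *)

Section Characters.
Variables (R : realFieldType) (C : fieldType) (iota : {rmorphism R -> C}).
Variables (E : R -> C) (t0 : R).
Hypotheses (ED : forall a b, E (a + b) = E a * E b) (E0 : E 0 = 1) (Et0 : E t0 != 1).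

Lemma character_neq0 a : E a != 0.
Proof.
apply/eqP => Ea; have /eqP := oner_neq0 C; apply.
by rewrite -E0 -(subrr a) ED Ea mul0r.
Qed.

Lemma poly_eq0_iota (p : {poly C}) : (forall s, p.[iota s] = 0) -> p = 0.
Proof.
move=> p0; apply: (@roots_geq_poly_eq0 _ p [seq iota k%:R | k <- seq.iota 0 (size p)]).
- by apply/allP => _ /mapP[k _ ->]; apply/rootP; apply: p0.
- rewrite map_inj_uniq ?iota_uniq // => i j /fmorph_inj /eqP.
  by rewrite eqr_nat => /eqP.
- by rewrite size_map size_iota.
Qed.

(** A translation of the variable preserves the leading coefficient, so the top terms cancel. *)
Lemma size_shift_sub (p : {poly C}) c n : (size p <= n.+1)%N ->
  (size (p \Po ('X + c%:P) - p)%R <= n)%N.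
Proof.
move=> pn; apply/leq_sizeP => i ni; rewrite coefB.
have sc : size (p \Po ('X + c%:P)) = size p by apply: size_comp_poly2; rewrite size_XaddC.
have [spi|ips] := leqP (size p) i.
  by rewrite !nth_default ?sc // subrr.
have -> : i = (size p).-1 by apply/eqP; rewrite eqn_leq; lia.
rewrite -{1}sc -!/(lead_coef _) lead_coef_comp ?size_XaddC //.
by rewrite lead_coefXaddC expr1n mulr1 subrr.
Qed.

(* Each shift operator [Q y |-> E (h (y - x0)) Q y (X + h) - Q y] preserves the
   hypothesis and lowers the degree of [Q x0]; for [y != x0] it is injective
   once [E (h (y - x0)) != 1]. *)
Lemma char_poly_indep (xs : seq R) (Q : R -> {poly C}) : uniq xs ->
  (forall s, \sum_(x <- xs) (Q x).[iota s] * E (s * x) = 0) ->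
  forall x, x \in xs -> Q x = 0.
Proof.
elim: xs Q => // x0 xs IHxs Q /= /andP[x0xs uxs].
move: {-1}(size _) (leqnn (size (Q x0))) => n.
elim: n Q => [|n IHn] Q sQ Q0 x.
  move: sQ; rewrite leqn0 size_poly_eq0 => /eqP Qx0.
  rewrite inE => /predU1P[->//|xxs]; apply: IHxs xxs => // s.
  by have := Q0 s; rewrite big_cons Qx0 horner0 mul0r add0r.
have Q'0 h y : y \in x0 :: xs ->
    (E (h * (y - x0)))%:P * (Q y \Po ('X + (iota h)%:P)) - Q y = 0.
  move: y; apply: (IHn (fun y =>
    (E (h * (y - x0)))%:P * (Q y \Po ('X + (iota h)%:P)) - Q y)).
    by rewrite subrr mulr0 E0 mul1r; exact: size_shift_sub.
  move=> s; under eq_bigr => y _.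
    rewrite !hornerE horner_comp !hornerE -rmorphD /= mulrBl.
    rewrite (_ : _ * E (s * y) = E (- (h * x0)) * ((Q y).[iota (s + h)] * E ((s + h) *
      y))).
      over.
    rewrite mulrCA -ED mulrAC -ED mulrC; congr (_ * E _); ring.
  by rewrite sumrB -mulr_sumr !Q0 mulr0 subrr.
have Qxs y : y \in xs -> Q y = 0.
  move=> yxs; have yx0 : y - x0 != 0.
    by rewrite subr_eq0; apply: contraNneq x0xs => <-.
  (* This shift makes the character value [E t0], which is not 1; comparing leading coefficients
     then forces that of [Q y] to vanish. *)
  have := Q'0 (t0 / (y - x0)) y; rewrite inE yxs orbT divfK // => /(_ isT).
  move/eqP; rewrite subr_eq0 => /eqP /(congr1 lead_coef) /eqP.
  rewrite lead_coefM lead_coefC lead_coef_comp ?size_XaddC //.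
  rewrite lead_coefXaddC expr1n mulr1 -[X in _ == X]mul1r -subr_eq0 -mulrBl.
  by rewrite mulf_eq0 subr_eq0 (negPf Et0) lead_coef_eq0 => /eqP.
rewrite inE => /predU1P[->|/Qxs//]; apply: poly_eq0_iota => s.
have := Q0 s; rewrite big_cons big_seq big1 => [|y /Qxs ->];
  last by rewrite horner0 mul0r.
by move/eqP; rewrite addr0 mulf_eq0 (negPf (character_neq0 _)) orbF => /eqP.
Qed.

(** Clearing the negative powers and grouping the terms by knot gives a relation to which
    [char_poly_indep] applies. *)
Lemma char_power_indep (theta : C) (D : seq (C * (nat * R))) : theta != 0 ->
  (forall s, s != 0 ->
     gsum (fun v => E (s * v.2) * (theta * iota s) ^- v.1) D = 0) ->
  gcoef D =1 (fun=> 0).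
Proof.
move=> th0 D0 [n y]; apply/eqP; apply/negPn/negP => Dny.
(* The relation is multiplied by the power [N.+1] rather than [N]: every term then keeps a positive
   power of [s], so the new relation also holds at [s = 0], a point excluded from the hypothesis. *)
pose N := \max_(t <- D) t.2.1.
have leN t : t \in D -> (t.2.1 <= N)%N by move=> tD; apply: leq_bigmax_seq.
have /mapP[t0' t0D ny] := gcoef_mem Dny.
have nN : (n <= N)%N by have := leN _ t0D; rewrite -ny.
have yD : y \in [seq t.2.2 | t <- D].
  by apply/mapP; exists t0' => //; rewrite -ny.
pose Q z : {poly C} := \sum_(t <- D | t.2.2 == z)
  (t.1 * theta ^+ (N.+1 - t.2.1)) *: 'X^(N.+1 - t.2.1).
have Qy : Q y = 0.
  apply: (@char_poly_indep (undup [seq t.2.2 | t <- D]));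
    rewrite ?undup_uniq ?mem_undup // => s.
  under eq_bigr do rewrite horner_sum mulr_suml big_mkcond /=.
  rewrite exchange_big /=.
  transitivity (\sum_(t <- D) t.1 * (theta * iota s) ^+ (N.+1 - t.2.1) * E (s * t.2.2)).
    apply: eq_big_seq => t tD.
    rewrite (bigD1_seq t.2.2) ?undup_uniq ?mem_undup /= ?(map_f (fun t => t.2.2)) //.
    rewrite eqxx big1 ?addr0 => [|z /negPf zt];
      first by rewrite hornerZ hornerXn exprMn mulrA.
    by rewrite eq_sym zt.
  have [->|s0] := eqVneq s 0.
    rewrite big_seq big1 // => t tD; rewrite rmorph0 mulr0 expr0n.
    by rewrite subSn ?leN //= mulr0 mul0r.
  have := congr1 (fun z => (theta * iota s) ^+ N.+1 * z) (D0 _ s0).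
  rewrite /= mulr0 /gsum mulr_sumr; apply: etrans; apply: eq_big_seq => t tD.
  have ts0 : theta * iota s != 0 by rewrite mulf_neq0 ?fmorph_eq0.
  rewrite expfB_cond ?(negPf ts0) ?add0n 1?ltnW ?ltnS ?leN //; ring.
have : gcoef D (n, y) * theta ^+ (N.+1 - n) = (Q y)`_(N.+1 - n).
  rewrite /gcoef /gsum coef_sum mulr_suml [RHS]big_mkcond.
  apply: eq_big_seq => t /leN tN; rewrite -pair_eqE /= coefZ coefXn.
  case: (t.2.2 == y); rewrite ?andbF ?mulr0 ?mul0r // andbT.
  rewrite (_ : (N.+1 - n == N.+1 - t.2.1)%N = (t.2.1 == n)); last first.
    by apply/eqP/eqP => e; lia.
  by case: eqP => [->|]; rewrite ?mulr0 ?mul0r ?mulr1.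
rewrite Qy coef0 => /eqP; rewrite mulf_eq0 (negPf Dny) expf_eq0.
by rewrite (negPf th0) andbF.
Qed.

End Characters.

(** * An additive extension of the conjugation of [Q(lam)] *)

Section Conjugation.
Variables (R : realFieldType) (lam : R).
Hypothesis lam2 : lam ^+ 2 = 10.

Definition qlam (a b : rat) : R := ratr a + ratr b * lam.

(** The 2-adic valuation is even on the left and odd on the right. *)
Lemma sqr_neq10 (m n : nat) : (0 < n)%N -> (m ^ 2 != 10 * n ^ 2)%N.
Proof.
move=> n0; apply/eqP => e; have := congr1 (logn 2) e.
rewrite lognX lognM ?expn_gt0 ?n0 // lognX (_ : logn 2 10 = 1%N) //; lia.
Qed.

(** This is the norm of [a + b lam]; if it vanished, 10 would be the square of the rational
    [a / b]. *)
Lemma qlam_norm (a b : rat) : (a != 0) || (b != 0) -> a ^+ 2 - 10 * b ^+ 2 != 0.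
Proof.
move=> ab; apply/negP; rewrite subr_eq0 => /eqP e.
have b0 : b != 0.
  by apply: contraTneq ab => b0; move: e; rewrite b0 expr0n mulr0 eqxx orbF => /eqP;
    rewrite sqrf_eq0 negbK.
pose c := a / b.
have c2 : c ^+ 2 = 10 by rewrite expr_div_n e mulfK // expf_neq0.
have : numq c ^+ 2 = 10 * denq c ^+ 2.
  apply: (@intr_inj rat); rewrite !expr2 !intrM numqE mulrACA -expr2 c2.
  by rewrite -[10 in RHS]/(10%:R%:~R) -[10 in LHS]/(10%:R).
move/(congr1 absz); rewrite abszM !abszX => /eqP; apply/negP.
by apply: sqr_neq10; rewrite absz_gt0 denq_neq0.
Qed.

Lemma qlam_mul a b c d : qlam a b * qlam c d = qlam (a * c + 10 * b * d) (a * d + b * c).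
Proof.
rewrite /qlam !rmorphD /= !rmorphM /= (rmorph_nat _ 10).
transitivity (ratr a * ratr c + lam ^+ 2 * ratr b * ratr d + (ratr a * ratr d + ratr b
  * ratr c) * lam).
  by ring.
by rewrite lam2.
Qed.

Lemma qlam_inv (a b : rat) : (a != 0) || (b != 0) -> exists c d, qlam c d * qlam a b = 1.
Proof.
move=> /qlam_norm N0; set N := _ - _ in N0.
exists (a / N), (- b / N); rewrite qlam_mul /qlam.
rewrite (_ : _ / N * b + _ = 0); last by field.
rewrite (_ : _ / N * a + _ = 1); last by rewrite /N; field.
by rewrite rmorph1 rmorph0 mul0r addr0.
Qed.

(* A maximal Q(lam)-subspace [W] not containing 1 satisfies
   [R = Q(lam) + W]; the map is conjugation on Q(lam) and 0 on [W]. *)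
Lemma conjugation_exists : exists sigma : R -> R,
  [/\ {morph sigma : x y / x + y}, sigma 1 = 1 &
      forall x, sigma (lam * x) = - (lam * sigma x)].
Proof.
pose sub (W : set R) := [/\ forall x y, W x -> W y -> W (x + y),
  forall a b x, W x -> W (qlam a b * x) & ~ W 1].
have [F Fsub Ftot|W [[WD WM W1] Wmax]] := @Zorn_bigcup R sub.
  split.
  - move=> x y [X FX Xx] [Y FY Yy]; have [XY|YX] := Ftot _ _ FX FY.
    + by exists Y => //; have [YD _ _] := Fsub _ FY; apply: YD => //; apply: XY.
    + by exists X => //; have [XD _ _] := Fsub _ FX; apply: XD => //; apply: YX.
  - by move=> a b x [X FX Xx]; exists X => //; have [_ XM _] := Fsub _ FX; apply: XM.
  - by move=> [X FX X1]; have [_ _] := Fsub _ FX; apply.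
have q00 : qlam 0 0 = 0 by rewrite /qlam rmorph0 mul0r addr0.
have qD a b c d : qlam a b + qlam c d = qlam (a + c) (b + d).
  by rewrite /qlam !rmorphD /=; ring.
have qN a b : - qlam a b = qlam (- a) (- b).
  by rewrite /qlam !rmorphN /=; ring.
have qN1 x : qlam (-1) 0 * x = - x by rewrite /qlam rmorphN1 rmorph0; ring.
have qlam01 x : qlam 0 1 * x = lam * x by rewrite /qlam rmorph0 rmorph1; ring.
have q10 : qlam 1 0 = 1 by rewrite /qlam rmorph0 rmorph1; ring.
(* Members of [sub] may be empty, so that the union of an empty chain qualifies; 0 is adjoined
   here. *)
pose W0 x := W x \/ x = 0.
have W0D u v : W0 u -> W0 v -> W0 (u + v).
  by move=> [Wu|->] [Wv|->]; rewrite ?addr0 ?add0r; [left; apply: WD|left|left|right].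
have W0M a b u : W0 u -> W0 (qlam a b * u).
  by move=> [Wu|->]; [left; apply: WM|right; rewrite mulr0].
have dec x : exists ab : rat * rat, W0 (x - qlam ab.1 ab.2).
  have [Wx|nWx] := pselect (W x).
    by exists (0, 0); left; rewrite q00 subr0.
  apply: contrapT => nex.
  (* Without a decomposition of [x], adjoining [x] to [W] would give a larger member of [sub]: an
     equation [1 = w + qlam a b * x] with [(a, b)] nonzero could be solved for [x]. *)
  apply: (Wmax (fun z => exists a b w, W0 w /\ z = w + qlam a b * x)).
    split => [w Ww|Wsub].
      by exists 0, 0, w; split; [left|rewrite q00; ring].
    by apply: nWx; apply: Wsub; exists 1, 0, 0; split; [right|rewrite q10; ring].
  split.
  - move=> _ _ [a [b [w [Ww ->]]]] [c [d [v [Wv ->]]]].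
    by exists (a + c), (b + d), (w + v); split; [exact: W0D|rewrite -qD; ring].
  - move=> c d _ [a [b [w [Ww ->]]]].
    exists (c * a + 10 * d * b), (c * b + d * a), (qlam c d * w).
    by split; [exact: W0M|rewrite -qlam_mul; ring].
  - move=> [a [b [w [Ww e]]]].
    have [/qlam_inv[c [d cd]]|] := boolP ((a != 0) || (b != 0)).
      apply: nex; exists (c, d) => /=.
      rewrite (_ : _ - _ = qlam (-1) 0 * (qlam c d * w)); first exact/W0M/W0M.
      by rewrite qN1 -[qlam c d in LHS]mulr1 e mulrDr mulrA cd; ring.
    rewrite negb_or !negbK => /andP[/eqP a0 /eqP b0].
    move: e; rewrite a0 b0 q00 mul0r addr0 => e; case: Ww => Ww.
      by apply: W1; rewrite e.
    by have /eqP := oner_neq0 R; rewrite e Ww.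
pose co x := projT1 (cid (dec x)).
have coP x : W0 (x - qlam (co x).1 (co x).2) by exact: (projT2 (cid (dec x))).
have W0q a b : W0 (qlam a b) -> a = 0 /\ b = 0.
  have [/[dup] ab /qlam_inv[c [d cd]]|] := boolP ((a != 0) || (b != 0)); last first.
    by rewrite negb_or !negbK => /andP[/eqP-> /eqP->].
  move=> /(W0M c d); rewrite cd => -[//|/eqP]; by rewrite oner_eq0.
(* Uniqueness of the [Q(lam)]-component yields both additivity and compatibility with multiplication
   by [lam]. *)
have coU x a b : W0 (x - qlam a b) -> co x = (a, b).
  move=> xab; have := W0D _ _ (coP x) (W0M (-1) 0 _ xab).
  rewrite qN1 (_ : _ + _ = qlam (a - (co x).1) (b - (co x).2)); last first.
    by rewrite -qD -qN; ring.
  by case/W0q => /subr0_eq -> /subr0_eq ->; rewrite -surjective_pairing.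
exists (fun x => qlam (co x).1 (- (co x).2)); split.
- move=> x y; rewrite (coU (x + y) ((co x).1 + (co y).1) ((co x).2 + (co y).2)) /=.
    by rewrite opprD qD.
  rewrite -qD (_ : _ - _ = (x - qlam (co x).1 (co x).2) + (y - qlam (co y).1 (co
    y).2)); last by ring.
  exact: W0D.
- by rewrite (coU 1 1 0) ?oppr0 ?q10 //; right; rewrite subrr.
- move=> x; rewrite (coU (lam * x) (10 * (co x).2) (co x).1) /=.
    by rewrite -qlam01 qlam_mul qN; congr qlam; ring.
  rewrite -qlam01 (_ : _ - _ = qlam 0 1 * (x - qlam (co x).1 (co x).2)); first exact: W0M.
  by rewrite mulrBr qlam_mul; congr (_ - qlam _ _); ring.
Qed.

End Conjugation.

Local Open Scope classical_set_scope.
Local Open Scope ring_scope.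

(** * Piecewise polynomials: integrals and convolutions through jumps *)

Section PiecewiseIntegrals.
Variable R : realType.
Implicit Types (p : {poly R}) (E : seq (R * {poly R})) (kappa : nat -> R -> R) (a b x y
  : R).
Local Notation mu := (@lebesgue_measure R).

Lemma continuous_integrable_itv (f : R -> R) a b : continuous f ->
  mu.-integrable `[a, b] (EFin \o f).
Proof.
move=> cf; apply: continuous_compact_integrable; first exact: segment_compact.
exact: continuous_subspaceT.
Qed.

Lemma continuous_FTC2_real (f F : R -> R) a b : a <= b -> continuous f ->
  (forall x, is_derive x 1 F (f x)) -> \int[mu]_(x in `[a, b]) f x = F b - F a.
Proof.
rewrite le_eqVlt => /predU1P[<- _ _|ab cf dF].
  by rewrite set_itv1 Rintegral_set1 subrr.
have Fcont : continuous F.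
  by move=> x; apply: differentiable_continuous; apply/derivable1_diffP;
    exact: (@ex_derive _ _ _ _ _ _ _ (dF x)).
rewrite /Rintegral (continuous_FTC2 (F := F)) //.
- exact: continuous_subspaceT.
- split; [by move=> x _; exact: (@ex_derive _ _ _ _ _ _ _ (dF x))|..].
  + exact/cvg_at_right_filter/Fcont.
  + exact/cvg_at_left_filter/Fcont.
- by move=> x _; rewrite derive1E; exact: (@derive_val _ _ _ _ _ _ _ (dF x)).
Qed.

(** The antiderivative of [p * kappa 0] obtained by integrating by parts until [p] is exhausted. *)
Definition poly_prim kappa p x : R :=
  - \sum_(m < size p) p^`(m).[x] * kappa m.+1 x.

(* Along such a family, repeated integration by parts reduces the integral of
   [f * kappa 0] to the jumps of the derivatives of [f]. *)
Definition weights kappa :=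
  continuous (kappa 0%N) /\ forall m x, is_derive x 1 (kappa m.+1) (- kappa m x).

(** The product rule makes the sum telescope down to the derivative of order [size p], which is
    0. *)
Lemma poly_prim_derive kappa p x : weights kappa ->
  is_derive x 1 (poly_prim kappa p) (p.[x] * kappa 0%N x).
Proof.
move=> [_ dk].
pose h (m : 'I_(size p)) (y : R) : R := p^`(m).[y] * kappa m.+1 y.
pose dh (m : 'I_(size p)) : R := p^`(m.+1).[x] * kappa m.+1 x - p^`(m).[x] * kappa m x.
have Dh m : is_derive x 1 (h m) (dh m).
  apply: is_derive_eq (is_deriveM (is_derive_poly _ _) (dk m x)) _.
  by rewrite /dh -derivnS /GRing.scale /=; ring.
have := is_deriveN (is_derive_sum Dh).
rewrite (_ : - (\sum_(i < size p) h i) = poly_prim kappa p); last first.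
  by apply/funext => y; rewrite /poly_prim fctE fct_sumE.
move/is_derive_eq; apply; rewrite -(big_mkord xpredT (fun m =>
  p^`(m.+1).[x] * kappa m.+1 x - p^`(m).[x] * kappa m x)).
rewrite telescope_sumr // opprB.
by rewrite (derivn_poly0 (leqnn (size p))) horner0 mul0r subr0 derivn0.
Qed.

Lemma continuous_weight kappa p : weights kappa ->
  continuous (fun x => p.[x] * kappa 0%N x).
Proof. by move=> [ck _] x; apply: cvgM; [exact: continuous_horner|exact: ck]. Qed.

Lemma integral_poly_weight kappa p a b : weights kappa -> a <= b ->
  \int[mu]_(x in `[a, b]) (p.[x] * kappa 0%N x) = poly_prim kappa p b - poly_prim kappa
    p a.
Proof.
move=> wk ab; apply: continuous_FTC2_real => //; first exact: continuous_weight.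
by move=> x; exact: poly_prim_derive.
Qed.

Lemma integrable_scale (d : measure_display) (T : measurableType d)
    (m : {measure set T -> \bar R}) (D : set T) (k : R) (f : T -> R) :
  measurable D -> m.-integrable D (EFin \o f) ->
  m.-integrable D (EFin \o (fun z => k * f z)).
Proof. by move=> mD /(integrableZl mD k); apply: eq_integrable. Qed.

Lemma Rintegral_sum (d : measure_display) (T : measurableType d)
    (m : {measure set T -> \bar R}) (I : Type) (r : seq I) (F : I -> T -> R)
    (D : set T) :
  measurable D -> (forall i, m.-integrable D (EFin \o F i)) ->
  m.-integrable D (EFin \o (fun z => \sum_(i <- r) F i z)) /\
  \int[m]_(z in D) (\sum_(i <- r) F i z) = \sum_(i <- r) \int[m]_(z in D) F i z.
Proof.
move=> mD iF; elim: r => [|i r [IH1 IH2]].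
  rewrite big_nil; under [X in Rintegral _ _ X]eq_fun do rewrite big_nil.
  split; last by rewrite Rintegral_cst // mul0r.
  by move: (integrable0 m D); apply: eq_integrable => // z _ /=; rewrite big_nil.
split.
  by move: (integrableD mD (iF i) IH1); apply: eq_integrable => // z _ /=;
    rewrite big_cons.
rewrite big_cons -IH2 -RintegralD //.
by apply: eq_Rintegral => z _; rewrite big_cons.
Qed.

(** A pair [(y, p)] records the change [p] of the polynomial piece at the knot [y]. *)
Definition pp E x : R := \sum_(t <- E) (if t.1 <= x then t.2.[x] else 0).

Lemma truncated_integral (f : R -> R) a b y : continuous f -> a <= y ->
  mu.-integrable `[a, b] (EFin \o (fun x => if y <= x then f x else 0)) /\
  \int[mu]_(x in `[a, b]) (if y <= x then f x else 0) =
    \int[mu]_(x in `[y, b]) f x.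
Proof.
move=> cf ay.
have -> : (fun x => if y <= x then f x else 0) = f \_ `[y, +oo[%classic.
  apply/funext => x; rewrite patchE; case: ifPn => yx.
    by rewrite mem_set //= in_itv /= yx.
  by rewrite memNset //= in_itv /= andbT; apply/negP.
have e : (`[a, b] `&` `[y, +oo[)%classic = `[y, b]%classic.
  apply/seteqP; split => x /=; rewrite !in_itv /= ?andbT.
    by move=> [/andP[_ ->] ->].
  by move=> /andP[yx ->]; rewrite yx (le_trans ay).
split; last by rewrite -Rintegral_mkcondr e.
rewrite -restrict_EFin; apply/integrable_restrict => //.
by rewrite e; exact: continuous_integrable_itv.
Qed.

Lemma pp_weight_eq kappa E x :
  pp E x * kappa 0%N x = \sum_(t <- E) (if t.1 <= x then t.2.[x] * kappa 0%N x else 0).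
Proof. by rewrite /pp mulr_suml; apply: eq_bigr => t _; case: ifP; rewrite ?mul0r. Qed.

Lemma pp_integral kappa E a b : weights kappa -> (forall t, t \in E -> a <= t.1) ->
  mu.-integrable `[a, b] (EFin \o (fun x => pp E x * kappa 0%N x)) /\
  \int[mu]_(x in `[a, b]) (pp E x * kappa 0%N x) =
    \sum_(t <- E | t.1 <= b) (poly_prim kappa t.2 b - poly_prim kappa t.2 t.1).
Proof.
move=> wk aE.
(* The maximum with [a] makes every [F t] integrable, also for [t] outside [E], as [Rintegral_sum]
   demands; on [E] it equals [t.1]. *)
pose F (t : R * {poly R}) x :=
  if Num.max a t.1 <= x then t.2.[x] * kappa 0%N x else 0.
have eF x : pp E x * kappa 0%N x = \sum_(t <- E) F t x.
  rewrite pp_weight_eq; apply: eq_big_seq => t tE.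
  by rewrite /F max_r // aE.
have tF t := @truncated_integral (fun x => t.2.[x] * kappa 0%N x) a b (Num.max a t.1)
   (@continuous_weight kappa t.2 wk).
have [t|iF iE] := @Rintegral_sum _ _ mu _ E F `[a, b] (measurable_itv _).
  by have [] := tF t; rewrite // le_max lexx.
have -> : (fun x => pp E x * kappa 0%N x) = (fun x => \sum_(t <- E) F t x).
  by apply/funext.
split => //; rewrite iE [RHS]big_mkcond; apply: eq_big_seq => t tE.
have [|_ ->] := tF t; first by rewrite le_max lexx.
rewrite max_r; last exact: aE.
case: ifPn => [tb|].
  exact: integral_poly_weight.
by rewrite -ltNge => bt; rewrite set_itv_ge ?Rintegral_set0 // -leNgt; exact: bt.
Qed.

(** Order [m] is stored as [m.+1]: convolving truncated powers of degrees [i] and [j] gives degree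
    [i + j + 1], so the shifted degrees add. *)
Definition jumps E : seq (R * (nat * R)) :=
  flatten [seq [seq (t.2^`(m).[t.1], (m.+1, t.1)) | m <- iota 0 (size t.2)] | t <- E].

Lemma gsum_jumps (Phi : nat * R -> R) E : gsum Phi (jumps E) =
  \sum_(t <- E) \sum_(m < size t.2) t.2^`(m).[t.1] * Phi (m.+1, t.1).
Proof.
rewrite /gsum big_flatten big_map; apply: eq_bigr => t _.
by rewrite big_map -{1}[size t.2]subn0 big_mkord.
Qed.

Lemma jumps_gt0 E t : t \in jumps E -> (0 < t.2.1)%N.
Proof. by move=> /flattenP[_ /mapP[u _ ->] /mapP[m _ ->]]. Qed.

Lemma jumps_knot E t : t \in jumps E -> exists2 u, u \in E & t.2.2 = u.1.
Proof. by move=> /flattenP[_ /mapP[u uE ->] /mapP[m _ ->]]; exists u. Qed.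

(** Taylor expansion of each change of piece at its own knot. *)
Lemma pp_jumps E x : pp E x = gsum (trunc x) (jumps E).
Proof.
rewrite gsum_jumps; apply: eq_bigr => t _; rewrite /trunc /=.
case: ifP => _; last by rewrite big1 // => m _; rewrite mulr0.
rewrite -[X in t.2.[X]](subrK t.1) addrC nderiv_taylor; last exact: mulrC.
apply: eq_bigr => m _; rewrite nderivn_def hornerMn -mulr_natr.
by field; rewrite pnatr_eq0 -lt0n fact_gt0.
Qed.

Lemma gsum_weight kappa E :
  gsum (fun v => kappa v.1 v.2) (jumps E) = - \sum_(t <- E) poly_prim kappa t.2 t.1.
Proof.
by rewrite gsum_jumps -sumrN; apply: eq_bigr => t _; rewrite /poly_prim opprK.
Qed.

(** The sum of all changes is the polynomial to the right of the last knot; as [pp] is 0 before the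
    first knot, its vanishing expresses compact support. *)
Definition cspline (f : R -> R) E := f =1 pp E /\ \sum_(t <- E) t.2 = 0.

Lemma pp_lt E x : (forall t, t \in E -> x < t.1) -> pp E x = 0.
Proof.
by move=> xE; rewrite /pp big_seq big1 // => t /xE; rewrite leNgt => ->.
Qed.

Lemma pp_ge E x : (forall t, t \in E -> t.1 <= x) -> pp E x = (\sum_(t <- E) t.2).[x].
Proof.
by move=> xE; rewrite horner_sum; apply: eq_big_seq => t /xE ->.
Qed.

Lemma knots_bounds E : exists a b, a <= b /\ forall t, t \in E -> a <= t.1 <= b.
Proof.
elim: E => [|u E [a [b [ab abE]]]]; first by exists 0, 0.
exists (Num.min a u.1), (Num.max b u.1); split; first by rewrite ge_min le_max ab.
move=> t; rewrite inE ge_min le_max => /predU1P[->|/abE/andP[-> ->//]].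
by rewrite lexx !orbT.
Qed.

Lemma poly_prim_sum kappa E x :
  \sum_(t <- E) poly_prim kappa t.2 x = poly_prim kappa (\sum_(t <- E) t.2) x.
Proof.
have ext p N : (size p <= N)%N ->
    poly_prim kappa p x = - \sum_(m < N) p^`(m).[x] * kappa m.+1 x.
  move=> pN; rewrite /poly_prim; congr (- _).
  rewrite (big_ord_widen N (fun m => p^`(m).[x] * kappa m.+1 x)) // big_mkcond.
  apply: eq_bigr => m _; case: ltnP => // pm.
  by rewrite derivn_poly0 // horner0 mul0r.
pose N := (\max_(t <- E) size t.2 + size (\sum_(t <- E) t.2)%R)%N.
rewrite (ext _ N) ?leq_addl //.
transitivity (\sum_(t <- E) - \sum_(m < N) t.2^`(m).[x] * kappa m.+1 x).
  apply: eq_big_seq => t tE; apply: ext; apply: leq_trans (leq_addr _ _).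
  exact: (@leq_bigmax_seq _ E xpredT (fun t => size t.2)).
rewrite sumrN exchange_big; congr (- _); apply: eq_bigr => m _ /=.
by rewrite raddf_sum horner_sum mulr_suml.
Qed.

Lemma cspline_outside f E a b x : cspline f E ->
  (forall t, t \in E -> a <= t.1 <= b) -> ~~ (a <= x <= b) -> f x = 0.
Proof.
move=> [fE E0] abE; rewrite fE negb_and -!ltNge => /orP[xa|bx].
  by apply: pp_lt => t /abE/andP[+ _]; exact: lt_le_trans.
by rewrite pp_ge ?E0 ?horner0 // => t /abE/andP[_ /le_trans]; apply; exact: ltW.
Qed.

Lemma cspline_restrict f E a b : cspline f E ->
  (forall t, t \in E -> a <= t.1 <= b) -> f = f \_ `[a, b]%classic.
Proof.
move=> fE abE; apply/funext => x; rewrite patchE; case: ifPn => // xab.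
by apply: cspline_outside fE abE _; apply: contra xab => xab; rewrite inE /= in_itv.
Qed.

(** The contributions at the right endpoint add up to the primitive attached to the zero polynomial,
    so only the values at the knots survive. *)
Lemma cspline_integral kappa f E : cspline f E -> weights kappa ->
  \int[mu]_x (f x * kappa 0%N x) = gsum (fun v => kappa v.1 v.2) (jumps E).
Proof.
move=> fE wk; have [a [b [ab abE]]] := knots_bounds E.
transitivity (\int[mu]_(x in `[a, b]) (f x * kappa 0%N x)).
  rewrite [RHS]Rintegral_mkcond; apply: eq_Rintegral => x _; rewrite patchE.
  case: ifPn => // xab; rewrite (cspline_outside fE abE) ?mul0r //.
  by apply: contra xab => xab; rewrite inE /= in_itv.
under eq_Rintegral do rewrite fE.1.
have [t|_ ->] := @pp_integral kappa E a b wk; first by move/abE/andP=> [].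
rewrite gsum_weight big_seq_cond.
rewrite (eq_bigl (fun t => t \in E)); last first.
  by move=> t; case: (boolP (t \in E)) => // /abE/andP[_ ->].
by rewrite -big_seq sumrB poly_prim_sum fE.2 /poly_prim size_poly0 big_ord0 oppr0 sub0r.
Qed.

(** The kernel at [m = 0] is [(x - y)^n / n!]. The case [n = 0] gives the constant 1, hence the
    mass; general [n] gives convolution with a truncated power. *)
Definition taylor_weight x n m y : R := (x - y) ^+ (n + m) / (n + m)`!%:R.

Lemma weights_taylor x n : weights (taylor_weight x n).
Proof.
pose q k : {poly R} := (x%:P - 'X) ^+ k * (k`!%:R^-1)%:P.
have qE m : taylor_weight x n m = horner (q (n + m)%N).
  by apply/funext => y; rewrite /q /taylor_weight !hornerE.
split; first by rewrite qE; exact: continuous_horner.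
move=> m y; rewrite !qE addnS; apply: is_derive_eq (is_derive_poly _ _) _.
rewrite /q derivM derivC mulr0 addr0 deriv_exp derivB derivC derivX sub0r /=.
rewrite hornerM hornerMn !hornerE factS natrM invfM -mulr_natr.
by field; rewrite -!natrD nat1r !pnatr_eq0 -lt0n fact_gt0.
Qed.

Lemma cspline_integrable f E : cspline f E -> mu.-integrable setT (EFin \o f).
Proof.
move=> fE; have [a [b [ab abE]]] := knots_bounds E.
rewrite (cspline_restrict fE abE) -restrict_EFin; apply/integrable_restrict => //.
rewrite setTI.
have [t|i1 _] := @pp_integral _ E a b (weights_taylor 0 0); first by move/abE/andP=> [].
by move: i1; apply: eq_integrable => // x _ /=;
  rewrite fE.1 /taylor_weight expr0 divr1 mulr1.
Qed.

Lemma cspline_mass f E : cspline f E ->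
  \int[mu]_x f x = gsum (fun v => (- v.2) ^+ v.1 / v.1`!%:R) (jumps E).
Proof.
move=> fE; rewrite (@eq_Rintegral _ _ _ mu setT (fun x => f x * taylor_weight 0 0 0 x)).
  rewrite (cspline_integral fE (weights_taylor 0 0)).
  by apply: eq_gsum => v; rewrite /taylor_weight sub0r.
by move=> x _; rewrite /taylor_weight expr0 divr1 mulr1.
Qed.

(** The kernel stops at [x - z], and integration by parts up to that point adds [(n, z)] to each
    jump exponent. *)
Lemma trunc_integral E a b x n z : (forall t, t \in E -> a <= t.1) -> (0 < n)%N ->
  mu.-integrable `[a, b] (EFin \o (fun y => pp E y * trunc (x - y) (n, z))) /\
  (x - z <= b -> \int[mu]_(y in `[a, b]) (pp E y * trunc (x - y) (n, z)) =
    gsum (fun v => trunc x (v + (n, z))) (jumps E)).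
Proof.
move=> aE n0; pose k := taylor_weight (x - z) n.-1.
have wk : weights k := weights_taylor _ _.
have -> : (fun y => pp E y * trunc (x - y) (n, z)) =
    (fun y => pp E y * k 0%N y) \_ `]-oo, x - z]%classic.
  apply/funext => y; rewrite patchE /trunc /= lerBrDl -lerBrDr; case: ifPn => yx.
    by rewrite mem_set /= ?in_itv //= /k /taylor_weight addn0;
      congr (_ * (_ ^+ _ / _)); ring.
  by rewrite memNset ?mulr0 //= in_itv /=; apply/negP.
have e : (`[a, b] `&` `]-oo, x - z])%classic = `[a, Num.min b (x - z)]%classic.
  apply/seteqP; split => y /=; rewrite !in_itv /= le_min.
    by move=> [/andP[-> ->] ->].
  by move=> /and3P[-> -> ->].
have [int_k intE] := pp_integral (Num.min b (x - z)) wk aE.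
split; first by rewrite -restrict_EFin; apply/integrable_restrict => //; rewrite e.
move=> xb; rewrite -Rintegral_mkcondr e intE min_r // gsum_jumps [LHS]big_mkcond.
apply: eq_bigr => t _; rewrite /trunc /= lerBrDr; case: ifPn => tx; last first.
  by rewrite big1 // => m _; rewrite mulr0.
(* At the endpoint [x - z] each weight is a positive power of 0, so only the knots contribute. *)
rewrite [X in X - _](_ : _ = 0); last first.
  rewrite /poly_prim big1 ?oppr0 // => m _.
  by rewrite /k /taylor_weight subrr addnS expr0n mul0r mulr0.
rewrite sub0r opprK; apply: eq_bigr => m _; rewrite /k /taylor_weight.
rewrite (_ : (n.-1 + m.+1)%N = (m + n)%N); last by lia.
by congr (_ * (_ ^+ _ / _)); ring.
Qed.

(** With [a] and [a'] to the left of all knots of [g] and [h], the integrand lives on [[a, x - a']].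
    Expanding [h] into its jumps reduces the claim to [trunc_integral]. *)
Lemma cspline_convolution g h E E' x : cspline g E -> cspline h E' ->
  convolution g h x = gsum (trunc x) (gmul (jumps E) (jumps E')).
Proof.
move=> gE hE; have [a [c [_ abE]]] := knots_bounds E.
have [a' [c' [_ abE']]] := knots_bounds E'; pose b := x - a'.
have aE t : t \in E -> a <= t.1 by move/abE/andP=> [].
have aE' t : t \in E' -> a' <= t.1 by move/abE'/andP=> [].
transitivity (\int[mu]_(y in `[a, b]) (g y * h (x - y))).
  rewrite [RHS]Rintegral_mkcond; apply: eq_Rintegral => y _; rewrite patchE.
  case: ifPn => // yab; have /negP : ~~ (a <= y <= b).
    by apply: contra yab => yab; rewrite inE /= in_itv.
  rewrite gE.1 hE.1; move/negP; rewrite negb_and -!ltNge => /orP[ya|yb].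
    by rewrite pp_lt ?mul0r // => t /aE; exact: lt_le_trans.
  by rewrite [X in _ * X]pp_lt ?mulr0 // => t /aE'; apply: lt_le_trans;
    rewrite /b in yb; lra.
(* Writing [t.2.1.-1.+1] keeps the degree positive for every [t]; on actual jumps it is [t.2.1]. *)
pose F (t : R * (nat * R)) y := t.1 * (pp E y * trunc (x - y) (t.2.1.-1.+1, t.2.2)).
have iF (t : R * (nat * R)) := trunc_integral b x t.2.2 aE (ltn0Sn t.2.1.-1).
rewrite (@eq_Rintegral _ _ _ mu _ (fun y => \sum_(t <- jumps E') F t y)); last first.
  move=> y _; rewrite gE.1 hE.1 (pp_jumps E') /gsum mulr_sumr.
  apply: eq_big_seq => t /jumps_gt0 t0; rewrite /F prednK // -surjective_pairing.
  by rewrite mulrCA.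
have [t|_ ->] := @Rintegral_sum _ _ mu _ (jumps E') F `[a, b]%classic (measurable_itv _).
  by apply: integrable_scale => //; exact: (iF t).1.
rewrite gsum_mul gsum_gsumC; apply: eq_big_seq => t tE'.
rewrite RintegralZl //; last exact: (iF t).1.
rewrite (iF t).2; last first.
  by have [u /aE' au ->] := jumps_knot tE'; rewrite /b lerD2l lerN2.
by rewrite prednK ?(jumps_gt0 tE') // -surjective_pairing.
Qed.

End PiecewiseIntegrals.

Local Open Scope complex_scope.

(** * From splines to knots and changes of piece *)

Section SplineRepresentation.
Variable R : realType.
Implicit Types (f : R -> R) (p : {poly R}) (E : seq (R * {poly R})) (a b x y : R).
Local Notation mu := (@lebesgue_measure R).

(** The changes are [P j.+1 - P j]; those at knots up to [x] telescope to the piece that contains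
    [x]. *)
Lemma spline_pp f : spline f -> exists p E, forall x, f x = p.[x] + pp E x.
Proof.
move=> [M [k [P [k0 kM k_lt fP]]]].
have k_mono i j : (i <= j <= M.+1)%N -> (k i <= k j)%E.
  elim: j => [|j IHj]; first by rewrite leqn0 => /andP[/eqP -> _].
  rewrite leq_eqVlt => /andP[/predU1P[->//|ij] jM].
  apply: le_trans (IHj _) (ltW (k_lt _ _)) => //.
  by rewrite -ltnS ij ltnW.
have k_fin j : (j < M)%N -> k j.+1 = (fine (k j.+1))%:E.
  move=> jM; rewrite fineK // fin_real //; apply/andP; split.
    by rewrite (le_lt_trans _ (k_lt j (ltnW jM))) ?leNye.
  by rewrite (lt_le_trans (k_lt _ jM)) ?leey.
exists (P 0%N), [seq (fine (k j.+1), P j.+1 - P j) | j <- iota 0 M] => x.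
have [J [JM kJ Jk]] : exists J, [/\ (J <= M)%N, (k J <= x%:E)%E & (x%:E < k J.+1)%E].
  have : exists n, [&& (n <= M)%N & (x%:E < k n.+1)%E].
    by exists M; rewrite leqnn kM ltry.
  move=> /ex_minnP[J /andP[JM Jk] Jmin]; exists J; split => //.
  case: J JM Jk Jmin => [|J] JM Jk Jmin; first by rewrite k0 leNye.
  rewrite leNgt; apply/negP => xk.
  by have := Jmin J; rewrite xk ltnW // ltnn => /(_ isT).
rewrite (fP J) // /pp big_map -{1}[M]subn0 big_mkord /=.
transitivity ((P 0%N).[x] + \sum_(j < M) (if (j < J)%N then (P j.+1).[x] - (P j).[x]
  else 0)).
  rewrite -big_mkcond -(big_ord_widen M (fun j => (P j.+1).[x] - (P j).[x])) //.
  by rewrite -(big_mkord xpredT (fun j => (P j.+1).[x] - (P j).[x])) telescope_sumr //;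
    ring.
congr (_ + _); apply: eq_bigr => j _; rewrite -lee_fin -k_fin //; case: ltnP => [jJ|Jj].
  by rewrite ifT ?hornerD ?hornerN // (le_trans _ kJ) // k_mono // jJ ltnW.
rewrite ifN // -ltNge; apply: lt_le_trans Jk _; apply: k_mono.
by rewrite !ltnS Jj /=; exact: ltnW (ltn_ord j).
Qed.

Lemma integrable_bounded_below (d : measure_display) (T : measurableType d)
    (m : {measure set T -> \bar R}) (f : T -> R) (A : set T) (e : R) :
  measurable A -> m A = +oo%E -> m.-integrable setT (EFin \o f) -> 0 < e ->
  ~ (forall z, A z -> e <= `|f z|).
Proof.
move=> mA Aoo intf e0 fe.
have [mf] := integrableP _ _ _ intf; apply/negP; rewrite -leNgt.
have -> : +oo%E = (\int[m]_(z in A) e%:E)%E by rewrite integral_cst // Aoo gt0_muley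
  ?lte_fin.
have mabs := measurable_int _ (integrable_abse intf).
apply: (@le_trans _ _ (\int[m]_(z in A) `|(EFin \o f) z|)%E).
  apply: ge0_le_integral => //; first by move=> z _; rewrite lee_fin ltW.
  exact: measurable_funS mabs.
by apply: ge0_subset_integral => // z _; rewrite lee_fin.
Qed.

(** The square of [p] has positive leading coefficient and eventually stays above it. *)
Lemma poly_norm_lbound p : p != 0 ->
  exists2 e, 0 < e & exists n, forall x, n <= x -> e <= `|p.[x]|.
Proof.
move=> p0; have q0 : 0 < lead_coef (p * p).
  by rewrite lead_coefM -expr2 exprn_even_gt0 //= lead_coef_eq0.
have [n n_p] := polyrcf.poly_pinfty_gt_lc q0.
exists (Num.sqrt (lead_coef (p * p))); first by rewrite sqrtr_gt0.
by exists n => x /n_p; rewrite hornerM -expr2 -sqrtr_sqr; exact: ler_wsqrtr.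
Qed.

Lemma poly_eq0_integrable_r f p b : mu.-integrable setT (EFin \o f) ->
  (forall x, b <= x -> f x = p.[x]) -> p = 0.
Proof.
move=> intf fp; apply/eqP; apply: contrapT => /negP /poly_norm_lbound[e e0 [n pe]].
apply: (@integrable_bounded_below _ _ mu f (`[Num.max b n, +oo[%classic) e _ _ intf e0).
- exact: measurable_itv.
- by have := lebesgue_measure_itv `[Num.max b n, +oo[; rewrite /= ltry; exact.
- by move=> x /=; rewrite in_itv /= andbT ge_max => /andP[bx nx]; rewrite fp // pe.
Qed.

Lemma poly_eq0_integrable_l f p b : mu.-integrable setT (EFin \o f) ->
  (forall x, x < b -> f x = p.[x]) -> p = 0.
Proof.
move=> intf fp; apply/eqP; apply: contrapT => /negP p0.
have /poly_norm_lbound[e e0 [n pe]] : p \Po (- 'X) != 0.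
  by rewrite comp_poly_eq0 // size_polyN size_polyX.
apply: (@integrable_bounded_below _ _ mu f (`]-oo, Num.min (b - 1) (- n)]%classic) e _
  _ intf e0).
- exact: measurable_itv.
- by have := lebesgue_measure_itv `]-oo, Num.min (b - 1) (- n)]; rewrite /= ltNyr; exact.
- move=> x /=; rewrite in_itv /= le_min => /andP[bx nx]; rewrite fp; last by lra.
  by have := pe (- x); rewrite horner_comp !hornerE opprK; apply; lra.
Qed.

(** A nonzero polynomial is not integrable on a half-line, so both unbounded pieces vanish. *)
Lemma spline_cspline f : spline f -> mu.-integrable setT (EFin \o f) ->
  exists E, cspline f E.
Proof.
move=> /spline_pp[p [E fE]] intf; have [a [b [ab abE]]] := knots_bounds E.
have p0 : p = 0.
  apply: (poly_eq0_integrable_l (b := a) intf) => x xa; rewrite fE pp_lt ?addr0 //.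
  by move=> t /abE/andP[+ _]; exact: lt_le_trans.
exists E; split; first by move=> x; rewrite fE p0 horner0 add0r.
apply: (poly_eq0_integrable_r (b := b) intf) => x bx; rewrite fE p0 horner0 add0r.
by apply: pp_ge => t /abE/andP[_ tb]; exact: le_trans tb bx.
Qed.

Lemma spline_cspline_compact f : spline f -> compactly_supported f ->
  exists E, cspline f E.
Proof.
move=> /spline_pp[p [E fE]] /compact_bounded[M [Mr Mb]].
have [a [b [ab abE]]] := knots_bounds E.
(* Neither knots nor support lie beyond [N], so on the unit intervals next to [- N] and [N] the
   outer polynomials agree with [f = 0]. *)
pose N : R := `|M| + `|a| + `|b| + 1.
have f0 x : N <= `|x| -> f x = 0.
  move=> Nx; apply/eqP; apply: contrapT => /negP fx.
  have cx : closure [set x | f x != 0] x by apply: subset_closure.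
  have MN : M < N - 1 / 2.
    have := ler_norm M; have := normr_ge0 a; have := normr_ge0 b; rewrite /N; lra.
  by have := Mb _ MN x cx; rewrite /=; lra.
have [N0 aN bN] : [/\ 0 <= N, - N < a & b < N].
  have := ler_norm b; have := ler_norm (- a); rewrite normrN.
  have := normr_ge0 a; have := normr_ge0 b; have := normr_ge0 M.
  by split; rewrite /N; lra.
have p0 : p = 0.
  apply: (@poly_eq0_itv _ _ (- N - 1) (- N)); first by clear -N0; lra.
  move=> x /andP[x1 x2]; rewrite -(f0 x).
    by rewrite fE pp_lt ?addr0 // => t /abE/andP[+ _]; apply: lt_le_trans;
      clear -aN x2; lra.
  by rewrite ler0_norm; clear -N0 x2; lra.
exists E; split; first by move=> x; rewrite fE p0 horner0 add0r.
apply: (@poly_eq0_itv _ _ N (N + 1)); first by clear -N0; lra.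
move=> x /andP[x1 x2]; rewrite -(f0 x); last by rewrite ger0_norm //; clear -N0 x1; lra.
rewrite fE p0 horner0 add0r pp_ge // => t /abE/andP[_ tb].
by rewrite (le_trans tb) //; clear -bN x1; lra.
Qed.

End SplineRepresentation.

(** * The Fourier transform in terms of jumps *)

Section Fourier.
Variable R : realType.
Implicit Types (f : R -> R) (E : seq (R * {poly R})) (a b s w x : R).
Local Notation mu := (@lebesgue_measure R).

Lemma expiD a b : expi (a + b) = expi a * expi b :> R[i].
Proof. by rewrite /expi cosD sinD; apply/eqP; rewrite eq_complex /=; apply/andP; split;
  apply/eqP; ring. Qed.

Lemma expi0 : expi 0 = 1 :> R[i].
Proof. by rewrite /expi cos0 sin0. Qed.

Definition expiN a : R[i] := expi (- a).

Lemma expiND a b : expiN (a + b) = expiN a * expiN b.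
Proof. by rewrite /expiN opprD expiD. Qed.

Lemma expiN0 : expiN 0 = 1.
Proof. by rewrite /expiN oppr0 expi0. Qed.

Lemma expiN_pi : expiN pi != 1.
Proof.
rewrite /expiN /expi cosN sinN cospi sinpi eq_complex /= negb_and; apply/orP; left.
by rewrite lt_eqF //; lra.
Qed.

Lemma mul_complex (a b c d : R) : (a +i* b) * (c +i* d) = (a * c - b * d) +i* (a * d +
  b * c).
Proof. by []. Qed.

(** Successive antiderivatives, up to sign, of the Fourier kernel [e^(-isx)], with [s = 2 pi w]. *)
Definition fourier_weight s m x : R[i] := expiN (s * x) * ('i * s%:C) ^- m.

Lemma fourier_weights s : s != 0 ->
  weights (fun m x => complex.Re (fourier_weight s m x)) /\
  weights (fun m x => complex.Im (fourier_weight s m x)).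
Proof.
move=> s0.
have fwE m x : fourier_weight s m x =
  (cos (s * x) * complex.Re (('i * s%:C) ^- m) + sin (s * x) * complex.Im (('i * s%:C)
    ^- m))
  +i* (cos (s * x) * complex.Im (('i * s%:C) ^- m) - sin (s * x) * complex.Re (('i *
    s%:C) ^- m)).
  rewrite /fourier_weight; case: (_ ^- m) => u v /=.
  by rewrite /expiN /expi cosN sinN mul_complex; congr (_ +i* _); ring.
have is0 : 'i * s%:C != 0.
  by rewrite mulf_neq0 ?eq_complex /= ?(negPf s0) ?oner_eq0 ?andbF.
have dcos x : is_derive x 1 (fun y => cos (s * y)) (- (s * sin (s * x))).
  apply: is_derive_eq (is_derive1_comp (is_derive_cos _) (is_deriveZ s (is_derive_id x
    1))) _.
  by rewrite /GRing.scale /=; ring.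
have dsin x : is_derive x 1 (fun y => sin (s * y)) (s * cos (s * x)).
  apply: is_derive_eq (is_derive1_comp (is_derive_sin _) (is_deriveZ s (is_derive_id x
    1))) _.
  by rewrite /GRing.scale /=; ring.
have dlin u v x : is_derive x 1 (fun y => cos (s * y) * u + sin (s * y) * v)
    (- (s * sin (s * x)) * u + s * cos (s * x) * v).
  have := is_deriveD (is_deriveZ u (dcos x)) (is_deriveZ v (dsin x)).
  rewrite (_ : _ \*: _ + _ = (fun y => cos (s * y) * u + sin (s * y) * v)); last first.
    by apply/funext => y; transitivity (u * cos (s * y) + v * sin (s * y)); [by []|ring].
  move/is_derive_eq; apply; transitivity (u * - (s * sin (s * x)) + v * (s * cos (s *
    x))); [by []|ring].
have zS m : ('i * s%:C) ^- m = (- (s * complex.Im (('i * s%:C) ^- m.+1)))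
    +i* (s * complex.Re (('i * s%:C) ^- m.+1)).
  rewrite [LHS](_ : _ = ('i * s%:C) * ('i * s%:C) ^- m.+1); last first.
    by rewrite exprS invfM mulrA divff // mul1r.
  by case: (_ ^- m.+1) => u v /=; rewrite !mul_complex; congr (_ +i* _); ring.
have dcont (g : R -> R) (dg : R -> R) : (forall x, is_derive x 1 g (dg x)) ->
  continuous g.
  move=> H x; apply: differentiable_continuous; apply/derivable1_diffP.
  exact: (@ex_derive _ _ _ _ _ _ _ (H x)).
split; split.
- under eq_fun do rewrite fwE; exact: dcont (dlin _ _).
- move=> m x; under eq_fun do rewrite fwE.
  rewrite fwE (zS m) /=; apply: is_derive_eq (dlin _ _ _) _; ring.
- under eq_fun do rewrite fwE -[- (sin _ * _)]mulrN /=; exact: dcont (dlin _ _).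
- move=> m x; under eq_fun do rewrite fwE /= -mulrN.
  rewrite fwE (zS m) /=; apply: is_derive_eq (dlin _ _ _) _; ring.
Qed.

Lemma complex_sum (I : Type) (r : seq I) (c : I -> R) (g : I -> R[i]) :
  \sum_(i <- r) (c i)%:C * g i =
  (\sum_(i <- r) c i * complex.Re (g i)) +i* (\sum_(i <- r) c i * complex.Im (g i)).
Proof.
elim: r => [|i r IH]; first by rewrite !big_nil.
rewrite !big_cons IH; case: (g i) => u v.
by rewrite mul_complex /=; apply/eqP; rewrite eq_complex /=; apply/andP; split;
  apply/eqP; ring.
Qed.

Definition complexify (D : seq (R * (nat * R))) : seq (R[i] * (nat * R)) :=
  [seq (t.1%:C, t.2) | t <- D].

Lemma gcoef_complexify D v : gcoef (complexify D) v = (gcoef D v)%:C.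
Proof.
rewrite /gcoef /gsum big_map rmorph_sum; apply: eq_bigr => t _ /=.
by rewrite rmorphM /= rmorph_nat.
Qed.

Lemma fourier_jumps f E w : cspline f E -> w != 0 ->
  fourier f w = gsum (fun v => fourier_weight (2 * pi * w) v.1 v.2) (complexify (jumps
    E)).
Proof.
move=> fE w0; have s0 : 2 * pi * w != 0 by rewrite !mulf_neq0 // ?pnatr_eq0 // gt_eqF
  // pi_gt0.
have [wr wi] := fourier_weights s0.
rewrite /gsum big_map /= complex_sum.
have := cspline_integral fE wr; have := cspline_integral fE wi; rewrite /gsum => <- <-.
rewrite /fourier; congr (_ +i* _); apply: eq_Rintegral => x _;
  by rewrite /fourier_weight /expiN /expi expr0 invr1 mulr1.
Qed.

Lemma fourier_mass f E : cspline f E ->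
  fourier f 0 = (gsum (fun v => (- v.2) ^+ v.1 / v.1`!%:R) (jumps E))%:C.
Proof.
move=> fE; rewrite -(cspline_mass fE) /fourier; congr (_ +i* _).
  by apply: eq_Rintegral => x _; rewrite mulr0 mul0r oppr0 cos0 mulr1.
transitivity (\int[mu]_(x in setT) (0 : R)); last by rewrite Rintegral_cst // mul0r.
by apply: eq_Rintegral => x _; rewrite mulr0 mul0r oppr0 sin0 mulr0.
Qed.

End Fourier.

(** * The refinement equation on formal sums *)

Section RefinableJumps.
Variable R : realType.
Implicit Types (D : seq (R * (nat * R))) (E : seq (R * {poly R})).

(** The jumps of [x |-> f (x / lam)]: a knot [y] moves to [lam * y], and the derivative of order
    [n - 1] is divided by [lam^(n - 1)]. *)
Definition dilate (lam : R) D : seq (R * (nat * R)) :=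
  [seq (t.1 * lam ^- t.2.1.-1, (t.2.1, lam * t.2.2)) | t <- D].

(** Evaluated at [x / lam], the refinement equation writes the dilated spline as a combination of
    translates. Translation by [d j] is multiplication by [z^(d j)], which has degree 0 in [T]. *)
Lemma refinable_jumps lam g E : 0 < lam -> refinable lam g -> cspline g E ->
  exists D, gcoef (dilate lam (jumps E)) =1 gcoef (gmul D (jumps E)).
Proof.
move=> lam0 [_ _ [N [c [d [_ g_ref]]]]] gE.
pose D : seq (R * (nat * R)) := [seq (c j, (0%N, d j)) | j <- enum 'I_N.+1]; exists D.
have gx x : g x = gsum (trunc x) (jumps E) by rewrite gE.1 pp_jumps.
suff DD0 : gcoef (dilate lam (jumps E) ++ gopp (gmul D (jumps E))) =1 (fun=> 0).
  move=> v; apply/eqP; rewrite -subr_eq0 -(DD0 v).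
  by rewrite /gcoef gsum_cat gsum_opp.
apply: trunc_indep => [t|x].
  rewrite mem_cat => /orP[/mapP[u /jumps_gt0 u0 ->] //|].
  move=> /mapP[_ /allpairsPdep[u [v [uD /jumps_gt0 v0 ->]]] ->] /=.
  by rewrite addn_gt0 v0 orbT.
rewrite gsum_cat gsum_opp gsum_mul; apply/eqP; rewrite subr_eq0; apply/eqP.
transitivity (g (x / lam)).
  rewrite gx /gsum big_map; apply: eq_bigr => t _ /=; rewrite -mulrA; congr (_ * _).
  rewrite /trunc /= ler_pdivlMr // [_ * lam]mulrC; case: ifP => _; last by rewrite mulr0.
  rewrite mulrA; congr (_ / _); rewrite -exprVn -exprMn; congr (_ ^+ _).
  by field; rewrite gt_eqF.
rewrite g_ref [RHS]/gsum big_map big_enum; apply: eq_bigr => j _ /=; congr (_ * _).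
rewrite [lam * _]mulrC divfK ?gt_eqF // gx; apply: eq_gsum => v; rewrite /trunc /=.
by rewrite lerBrDl opprD addrA.
Qed.

Definition on_knots (theta : R -> R) (v : nat * R) : nat * R := (v.1, theta v.2).

Lemma on_knots_additive theta : {morph theta : x y / x + y} ->
  {morph on_knots theta : u v / u + v}.
Proof. by move=> thetaD u v; rewrite /on_knots /= thetaD. Qed.

(** If [theta] kills [D], it kills the product and hence the dilation. Its coefficient at
    [(n, lam * z)] is a nonzero multiple of the coefficient at [(n, z)] of the push of [D] along
    [theta']. *)
Lemma push_refinable lam D D' theta theta' : 0 < lam ->
  gcoef (dilate lam D) =1 gcoef (gmul D' D) ->
  {morph theta : x y / x + y} -> (forall x, theta (lam * x) = lam * theta' x) ->
  gcoef (gpush (on_knots theta) D) =1 (fun=> 0) ->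
  gcoef (gpush (on_knots theta') D) =1 (fun=> 0).
Proof.
move=> lam0 D_ref thetaD theta_lam D0 [n z].
have : gcoef (gpush (on_knots theta) (dilate lam D)) (n, lam * z) = 0.
  rewrite (eq_gcoef_push _ D_ref) (gpush_mul _ _ (on_knots_additive thetaD)).
  by rewrite /gcoef gsum_mul gsum_gsumC gsum_eq0.
rewrite /gcoef !gsum_push /gsum big_map /=.
rewrite (eq_bigr (fun t => lam ^- n.-1 * (t.1 * (on_knots theta' t.2 == (n, z))%:R))).
  move/eqP; rewrite -mulr_sumr mulf_eq0 invr_eq0 expf_eq0 (gt_eqF lam0) andbF /=.
  by move/eqP.
move=> t _; rewrite /on_knots /= theta_lam !xpair_eqE (inj_eq (mulfI (lt0r_neq0 lam0))).
by case: eqP => [->|_]; rewrite ?mulr0 // mulrAC mulrC.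
Qed.

End RefinableJumps.

(** * The box spline: jumps, refinability, indecomposability *)

Section BoxSpline.
Variable R : realType.
Implicit Types (D : seq (R * (nat * R))) (E : seq (R * {poly R})) (B : R -> R).
Local Notation m := (Num.sqrt (5 / 2) : R).
Local Notation lam := (Num.sqrt 10 : R).

Lemma sqrt52_gt0 : 0 < m. Proof. by rewrite sqrtr_gt0; lra. Qed.
Lemma sqrt52_sqr : m ^+ 2 = 5 / 2. Proof. by rewrite sqr_sqrtr; lra. Qed.

Lemma sqrt10E : lam = 2 * m.
Proof.
have -> : 10 = 2 ^+ 2 * (5 / 2) :> R by lra.
by rewrite sqrtrM ?sqr_ge0 // sqrtr_sqr ger0_norm.
Qed.

Lemma sqrt10_sqr : lam ^+ 2 = 10. Proof. by rewrite sqr_sqrtr. Qed.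
Lemma sqrt10_gt0 : 0 < lam. Proof. by rewrite sqrtr_gt0. Qed.

Definition box_jumps : seq (R * (nat * R)) :=
  [:: (m^-1, (2%N, 0)); (- m^-1, (2%N, 1)); (- m^-1, (2%N, m)); (m^-1, (2%N, 1 + m))].

Lemma gsum_box Phi : gsum Phi box_jumps =
  m^-1 * (Phi (2%N, 0) - Phi (2%N, 1) - Phi (2%N, m) + Phi (2%N, 1 + m)).
Proof. by rewrite /gsum !big_cons big_nil /=; ring. Qed.

(** The prescribed transform is that of [box_jumps]; independence of the functions
    [e^(-isy) / (is)^n] then determines the jumps. *)
Lemma box_spline_jumps B : box_spline [:: 1; m] B ->
  exists2 E, cspline B E & gcoef (jumps E) =1 gcoef box_jumps.
Proof.
move=> [spB cB fB]; have [E BE] := spline_cspline_compact spB cB; exists E => //.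
suff D0 : gcoef (complexify (jumps E) ++ gopp (complexify box_jumps)) =1 (fun=> 0).
  move=> v; have := D0 v; rewrite /gcoef gsum_cat gsum_opp -!/(gcoef _ _)
    !gcoef_complexify.
  by move/subr0_eq/(congr1 (@complex.Re R)).
apply: (@char_power_indep R R[i] (real_complex R) (@expiN R) pi (@expiND R) (expiN0 R)
  (expiN_pi R) 'i).
  by rewrite eq_complex /= oner_eq0 andbF.
move=> s s0; pose w := s / (2 * pi).
have pi0 : pi != 0 :> R by rewrite gt_eqF // pi_gt0.
have sw : 2 * pi * w = s by rewrite /w mulrC divfK // mulf_neq0 // pnatr_eq0.
have w0 : w != 0 by rewrite /w mulf_neq0 // invr_eq0 mulf_neq0 // pnatr_eq0.
have := fourier_jumps BE w0; rewrite fB // sw gsum_cat gsum_opp => <-.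
rewrite !big_cons big_nil mulr1 /gsum !big_cons big_nil /=.
have -> : 2 * pi * m * w = s * m by rewrite -sw; ring.
rewrite !mulr1 sw -!/(expiN _) mulr0 mulrDr mulr1 expiN0 expiND.
have sC : 2 * pi%:C * w%:C = s%:C by rewrite -sw !rmorphM /= rmorph_nat.
have iC0 : 'i != 0 :> R[i] by rewrite eq_complex /= oner_eq0 andbF.
have mC0 : m%:C != 0 by rewrite fmorph_eq0 gt_eqF // sqrt52_gt0.
have sC0 : s%:C != 0 by rewrite fmorph_eq0.
have -> : 2 * pi%:C * 'i * w%:C = 'i * s%:C by rewrite -sC; ring.
have -> : 2 * pi%:C * 'i * m%:C * w%:C = 'i * s%:C * m%:C by rewrite -sC; ring.
rewrite !rmorphN /= !fmorphV /=.
set e1 := expiN s; set e2 := expiN _; move: mC0 sC0.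
move: m%:C s%:C => mc sc mc0 sc0; rewrite addr0.
by field; rewrite sc0 mc0 andbT; exact: iC0.
Qed.

Lemma box_refinable B E : cspline B E -> gcoef (jumps E) =1 gcoef box_jumps ->
  refinable lam B.
Proof.
move=> BE EB; split; first exact: cspline_integrable BE.
  rewrite (fourier_mass BE) (eq_gcoef_gsum _ EB) gsum_box.
  rewrite -[RHS](rmorph1 (real_complex R)) /=; congr (_ %:C).
  rewrite -[2%N`!]/2%N.
  have m0 := sqrt52_gt0; have m2 := sqrt52_sqr.
  by field; rewrite gt_eqF.
have m0 := sqrt52_gt0; have m2 := sqrt52_sqr; have lam0 := sqrt10_gt0.
pose t (u : R) := if 0 <= u then u else 0.
have Bx x : B x = m^-1 * (t x - t (x - 1) - t (x - m) + t (x - 1 - m)).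
  have tr y : trunc x (2%N, y) = t (x - y) by rewrite /trunc /t /= expr1 divr1 subr_ge0.
  by rewrite BE.1 pp_jumps (eq_gcoef_gsum _ EB) gsum_box !tr subr0 opprD addrA.
have tlam u : t (lam * u) = lam * t u.
  by rewrite /t pmulr_rge0 //; case: ifP; rewrite ?mulr0.
(* Since [lam = 2 m] and [lam m = 5], dividing [(1 - z^lam) (1 - z^(lam m))] by [(1 - z) (1 - z^m)]
   gives [(1 + z + z^2 + z^3 + z^4) (1 + z^m)]. Its exponents are listed in the order forced by
   [1 < m < 2]. *)
pose ds : seq R := [:: 0; 1; m; 2; 1 + m; 3; 2 + m; 4; 3 + m; 4 + m].
have m1 : 1 < m by nra.
have m_lt2 : m < 2 by nra.
exists 9%N, (fun=> lam^-1), (fun j => nth 0 ds j); split.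
  move=> i j ij; apply: (sorted_ltn_nth (@lt_trans _ R)) ij; rewrite ?inE ?ltn_ord //=.
  by rewrite /ds /=; do ![apply/andP; split]; rewrite //; lra.
move=> x; pose S (a b : nat) := t (lam * x - (a%:R + b%:R * m)).
have Bab a b : B (lam * x - (a%:R + b%:R * m)) =
    m^-1 * (S a b - S a.+1 b - S a b.+1 + S a.+1 b.+1).
  by rewrite Bx /S; congr (_ * (t _ - t _ - t _ + t _)); rewrite -?natr1; ring.
have S00 : S 0%N 0%N = lam * t x by rewrite -tlam /S; congr t; ring.
have S50 : S 5%N 0%N = lam * t (x - m).
  by rewrite -tlam /S; congr t; rewrite sqrt10E; lra.
have S02 : S 0%N 2%N = lam * t (x - 1) by rewrite -tlam /S sqrt10E; congr t; ring.
have S52 : S 5%N 2%N = lam * t (x - 1 - m).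
  by rewrite -tlam /S; congr t; rewrite sqrt10E; lra.
rewrite !big_ord_recl big_ord0 /=.
have Bd d a b : d = a%:R + b%:R * m -> lam^-1 * B (lam * x - d) =
    lam^-1 * m^-1 * (S a b - S a.+1 b - S a b.+1 + S a.+1 b.+1).
  by move=> ->; rewrite Bab mulrA.
rewrite (Bd 0 0%N 0%N) ?(Bd 1 1%N 0%N) ?(Bd m 0%N 1%N) ?(Bd 2 2%N 0%N) ?(Bd (1 + m) 1%N
  1%N);
  try by ring.
rewrite (Bd 3 3%N 0%N) ?(Bd (2 + m) 2%N 1%N) ?(Bd 4 4%N 0%N) ?(Bd (3 + m) 3%N 1%N)
  ?(Bd (4 + m) 4%N 1%N); try by ring.
(* The double sum telescopes to its four corner ramps. *)
transitivity (lam^-1 * m^-1 * (S 0%N 0%N - S 5%N 0%N - S 0%N 2%N + S 5%N 2%N));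
  last by ring.
rewrite S00 S50 S02 S52 Bx.
by field; rewrite !gt_eqF.
Qed.

Lemma box_jumps_weight (v : nat * R) : gcoef box_jumps v != 0 -> v.1 = 2%N.
Proof. by move/gcoef_mem => /=; rewrite !inE => /or4P[] /eqP ->. Qed.

Lemma box_jumps_neq0 : gcoef box_jumps (2%N, 0) != 0.
Proof.
have m0 := sqrt52_gt0; have m1 : 0 < 1 + m by rewrite addr_gt0.
rewrite /gcoef gsum_box !xpair_eqE /= oner_eq0 (gt_eqF m0) (gt_eqF m1) !eqxx.
by rewrite !subr0 addr0 mulr1 invr_eq0 gt_eqF.
Qed.

(* The top lexicographic coefficient of the product would sit in a degree
   [n >= 3], whereas the box spline lives in degree 2. *)
Lemma factor_degree D D' :
  (forall t, t \in D -> (0 < t.2.1)%N) -> (forall t, t \in D' -> (0 < t.2.1)%N) ->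
  gcoef (gmul D D') =1 gcoef box_jumps ->
  forall v, gcoef D v != 0 -> v.1 = 1%N.
Proof.
move=> D_gt0 D'_gt0 DD' v Dv.
have deg_gt0 (C : seq (R * (nat * R))) u : (forall t, t \in C -> (0 < t.2.1)%N) ->
  gcoef C u != 0 -> (0 < u.1)%N.
  by move=> C_gt0 /gcoef_mem /mapP[t /C_gt0 t0 ->].
have [v0 Dv0] : exists v0, gcoef D' v0 != 0.
  apply: contrapT => nD'; have := box_jumps_neq0; rewrite -DD' => /negP; apply.
  rewrite /gcoef gsum_mul gsum_gsumC gsum_eq0 // => u.
  by apply/eqP; apply: contrapT => /negP Du; apply: nD'; exists u.
have [u [w [vu v0w]]] := gcoef_mul_lex Dv Dv0; rewrite DD' => /box_jumps_weight.
have := deg_gt0 _ _ D_gt0 Dv; have := deg_gt0 _ _ D'_gt0 Dv0.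
have : (v.1 <= u.1)%N by case/orP: vu => [/ltnW|/andP[/eqP -> _]].
have : (v0.1 <= w.1)%N by case/orP: v0w => [/ltnW|/andP[/eqP -> _]].
rewrite -[(u + w).1]/(u.1 + w.1)%N; clear; lia.
Qed.

Lemma box_not_convolution B : box_spline [:: 1; m] B ->
  ~ exists g h, [/\ refinable_spline lam g, refinable_spline lam h &
                    B =1 convolution g h].
Proof.
move=> /box_spline_jumps[EB BEB EBbox] [g [h [[sg rg] [sh rh] Bgh]]].
have [int_g g1 _] := rg; have [int_h h1 _] := rh.
have [E gE] := spline_cspline sg int_g; have [E' hE'] := spline_cspline sh int_h.
have [M gM] := refinable_jumps sqrt10_gt0 rg gE.
have [M' hM'] := refinable_jumps sqrt10_gt0 rh hE'.
(* Independence of truncated powers turns the pointwise convolution identity into a product of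
   formal sums. *)
have gh : gcoef (gmul (jumps E) (jumps E')) =1 gcoef box_jumps.
  suff D0 : gcoef (gmul (jumps E) (jumps E') ++ gopp (jumps EB)) =1 (fun=> 0).
    move=> v; rewrite -EBbox; apply/eqP; rewrite -subr_eq0 -(D0 v).
    by rewrite /gcoef gsum_cat gsum_opp.
  apply: trunc_indep => [t|x].
    rewrite mem_cat => /orP[|/mapP[u /jumps_gt0 u0 ->] //].
    by move=> /allpairsPdep[u [v [/jumps_gt0 u0 _ ->]]] /=; rewrite addn_gt0 u0.
  rewrite gsum_cat gsum_opp -(cspline_convolution x gE hE') -Bgh BEB.1 pp_jumps.
  by rewrite subrr.
have hg : gcoef (gmul (jumps E') (jumps E)) =1 gcoef box_jumps.
  by move=> v; rewrite gmul_comm gh.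
have [sigma [sigmaD sigma1 sigma_lam]] := conjugation_exists sqrt10_sqr.
have sigma0 : sigma 0 = 0 by apply: (addrI (sigma 0)); rewrite -sigmaD !addr0.
have sigma_m : sigma m = - m.
  have : sigma (lam * 1) = - lam by rewrite sigma_lam sigma1 mulr1.
  by rewrite mulr1 sqrt10E mulr_natl mulr2n sigmaD; lra.
pose p x := (x - sigma x) / 2; pose q x := (x + sigma x) / 2.
have pD : {morph p : x y / x + y} by move=> x y; rewrite /p sigmaD; ring.
have qD : {morph q : x y / x + y} by move=> x y; rewrite /q sigmaD; ring.
have p_lam x : p (lam * x) = lam * q x by rewrite /p /q sigma_lam; ring.
(* [p] sends 0 and 1 to 0, and both [m] and [1 + m] to [m], so the four terms cancel in pairs. *)
have p_box : gcoef (gpush (on_knots p) box_jumps) =1 (fun=> 0).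
  move=> v; rewrite /gcoef gsum_push gsum_box /on_knots /= /p !sigmaD sigma0 sigma1
    sigma_m.
  rewrite (_ : (1 - 1) / 2 = (0 - 0) / 2); last by ring.
  rewrite (_ : (1 + m - (1 - m)) / 2 = (m - - m) / 2); last by ring.
  by ring.
have push0 theta D : gcoef (gpush (on_knots theta) D) =1 (fun=> 0) ->
    gsum (fun v => - 1 * (on_knots theta v).2) D = 0.
  move=> D0; rewrite (gsumMl _ (fun v => (on_knots theta v).2)).
  by rewrite -(gsum_push (on_knots theta) snd) gsum_eq0 // mulr0.
have factor_contra F F' f N : cspline f F -> fourier f 0 = 1 ->
    gcoef (dilate lam (jumps F)) =1 gcoef (gmul N (jumps F)) ->
    gcoef (gmul (jumps F) (jumps F')) =1 gcoef box_jumps ->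
    gcoef (gpush (on_knots p) (jumps F)) =1 (fun=> 0) -> False.
  move=> fF f1 F_ref FF' pF.
  have qF := push_refinable sqrt10_gt0 F_ref pD p_lam pF.
  have deg := factor_degree (@jumps_gt0 _ F) (@jumps_gt0 _ F') FF'.
  move: f1; rewrite (fourier_mass fF) => /(congr1 (@complex.Re R)) /= /eqP.
  (* The support lies in degree 1, where the mass weight is [- y = - p y - q y]; both parts
     contribute 0, against mass 1. *)
  rewrite (@eq_gsum_support _ _ _ (fun v => - 1 * (on_knots p v).2 + - 1 * (on_knots q
    v).2)).
    by rewrite gsumD !push0 // addr0 eq_sym oner_eq0.
  by move=> v /deg v1; rewrite v1 /= /p /q expr1 divr1; field.
have : gcoef (gmul (gpush (on_knots p) (jumps E)) (gpush (on_knots p) (jumps E'))) =1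
  (fun=> 0).
  move=> v; rewrite -(gpush_mul _ _ (on_knots_additive pD)) -(p_box v).
  exact: eq_gcoef_push.
case/gmul_eq0.
- exact: factor_contra gE g1 gM gh.
- exact: factor_contra hE' h1 hM' hg.
Qed.

End BoxSpline.

Theorem proposition2p5 (R : realType) (B : R -> R)
  (hB : box_spline [:: 1; Num.sqrt (5 / 2)] B) :
  indecomposable (Num.sqrt 10) B.
Proof.
split; last exact: box_not_convolution.
have [E BE EB] := box_spline_jumps hB.
by split; [case: hB|exact: box_refinable BE EB].
Qed.
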